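(* Let $F$ be a clause-set. Then the map $F' \mapsto \mathrm{pure}(D_F(F'))$ is a bijection from $\mathrm{mps}(F)$ to $\mathrm{prc}_0(D(F))$.
   Context: Clauses are finite sets of literals without complementary pair; clause-sets are finite sets of clauses; $\top$ is the empty clause-set. $F\models C$ means every satisfying assignment of $F$ satisfies $C$. $\mathrm{prc}_0(G)$ is the set of prime implicates of $G$ (inclusion-minimal clauses $C$ with $G \models C$). A clause-set $G$ is a minimal premise set (mps) for a clause $C$ if $G \models C$ and no proper subset $G' \subset G$ satisfies $G'\models C$; $G$ is an mps if it is an mps for some clause; $\mathrm{mps}(F)$ denotes the set of subsets of $F$ that are mps's. $\mathrm{pure}(G)$ is the set of pure literals of $G$: literals occurring in some clause of $G$ whose complement occurs in no clause of $G$. Doping: for the clause-set $F$ fix an injection assigning to each $C\in F$ a variable $u_C \notin \mathrm{var}(F)$, distinct for distinct clauses; $D(F) := \{C\cup\{u_C\} : C\in F\}$ and for $F'\subseteq F$, $D_F(F') := \{C \cup\{u_C\} : C \in F'\}$. *)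

(* Defs.v *)
From mathcomp Require Import all_boot.
From mathcomp Require Import finmap.
From mathcomp Require Import classical_sets functions.

Set Implicit Arguments.
Unset Strict Implicit.
Unset Printing Implicit Defensive.

Local Open Scope fset_scope.

(* The literal (x, b) is satisfied when x gets the value b: (x, true) is the
   variable x seen as a literal, (x, false) is its complement. *)
Notation literal V := (V * bool)%type.

(* A pre-clause may contain a complementary pair; [is_clause] and
   [is_clauseset] single out the genuine clauses and clause-sets. *)
Notation preclause V := {fset (V * bool)%type}.

Section Clauses.
Variable V : choiceType.

Definition compl (l : literal V) : literal V := (l.1, ~~ l.2).

Definition is_clause (C : preclause V) : Prop :=
  forall l, l \in C -> compl l \notin C.

Definition is_clauseset (F : {fset preclause V}) : Prop :=
  forall C, C \in F -> is_clause C.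

Definition lits (F : {fset preclause V}) : {fset literal V} := \bigcup_(C <- F) C.

Definition var (F : {fset preclause V}) : {fset V} := [fset l.1 | l in lits F].

Definition satisfies_clause (phi : V -> bool) (C : preclause V) : Prop :=
  exists2 l, l \in C & phi l.1 = l.2.

Definition satisfies (phi : V -> bool) (F : {fset preclause V}) : Prop :=
  forall C, C \in F -> satisfies_clause phi C.

Definition entails (F : {fset preclause V}) (C : preclause V) : Prop :=
  forall phi : V -> bool, satisfies phi F -> satisfies_clause phi C.

Definition implicate (F : {fset preclause V}) (C : preclause V) : Prop :=
  is_clause C /\ entails F C.

Definition prc0 (F : {fset preclause V}) : set (preclause V) :=
  [set C | implicate F C /\
           forall C' : preclause V, implicate F C' -> ~~ (C' `<` C)%fset]%classic.

Definition mps_for (G : {fset preclause V}) (C : preclause V) : Prop :=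
  entails G C /\ forall G' : {fset preclause V}, G' `<` G -> ~ entails G' C.

Definition is_mps (G : {fset preclause V}) : Prop :=
  exists2 C, is_clause C & mps_for G C.

Definition mps (F : {fset preclause V}) : set {fset preclause V} :=
  [set G : {fset preclause V} | (G `<=` F)%fset /\ is_mps G]%classic.

Definition pure (F : {fset preclause V}) : {fset literal V} :=
  [fset l in lits F | compl l \notin lits F].

(* [u] is total on pre-clauses, but only its values on F matter. *)
Definition doping_vars (F : {fset preclause V}) (u : preclause V -> V) : Prop :=
  {in F &, injective u} /\ forall C, C \in F -> u C \notin var F.

(* D_F(F') is [dope u F'] for u with [doping_vars F u]; D(F) is [dope u F]. *)
Definition dope (u : preclause V -> V) (F' : {fset preclause V}) :
    {fset preclause V} :=
  [fset ((u C, true) : literal V) |` C | C in F'].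

End Clauses.

(* Main.v *)
(** If [G] is a minimal premise set for a clause [C], then no literal of [G]
    clashes with [C] (a premise satisfied by falsifying [C] is superfluous), so
    [C] restricted to the literals of [G] consists of pure literals; conversely
    every pure literal of [G] lies in [C], since otherwise the premises
    containing it are superfluous.  Hence [pure G] is the least clause for which
    [G] is a minimal premise set.  A prime implicate of [D(F)] contains no
    negative doping literal, so it splits as a set [G] of doping variables,
    identified with a subset of [F], and a clause [K] over the old variables; it
    is an implicate iff [G] entails [K].  Minimality in [G] says that [G] is a
    minimal premise set for [K], and minimality in [K] says [K = pure G]. *)
Require Import Defs.
From mathcomp Require Import all_boot.
From mathcomp Require Import finmap.
From mathcomp Require Import classical_sets functions boolp.

(** * Minimal premise sets and their pure literals *)

Section MinimalPremiseSets.
Set Implicit Arguments.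
Unset Strict Implicit.
Local Open Scope fset_scope.
Variable V : choiceType.
Implicit Types (l : literal V) (C D E K : preclause V) (F G : {fset preclause V}).
Implicit Types (phi : V -> bool).

Lemma complK : involutive (@compl V).
Proof. by case=> x b; rewrite /compl /= negbK. Qed.

Lemma litsP F l : reflect (exists2 C, C \in F & l \in C) (l \in lits F).
Proof.
apply: (iffP (bigfcupP _ _ _ _)) => [[C] | [C CF lC]].
  by rewrite andbT => CF lC; exists C.
by exists C; rewrite ?CF.
Qed.

Lemma in_var F C l : C \in F -> l \in C -> l.1 \in var F.
Proof. by move=> CF lC; apply/in_imfset/litsP; exists C. Qed.

Lemma in_pure F l : (l \in pure F) = (l \in lits F) && (compl l \notin lits F).
Proof. by rewrite /pure !inE. Qed.

Lemma is_clause_pure F : is_clause (pure F).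
Proof. by move=> l; rewrite !in_pure => /andP[_ /negPf->]. Qed.

Lemma is_clause_sub C D : C `<=` D -> is_clause D -> is_clause C.
Proof.
move=> /fsubsetP CD clD l /CD lD; apply: contra (clD _ lD); exact: CD.
Qed.

Lemma satisfies_clause_sub phi C D :
  C `<=` D -> satisfies_clause phi C -> satisfies_clause phi D.
Proof. by move=> /fsubsetP CD [l /CD lD phil]; exists l. Qed.

Lemma not_entails F C :
  ~ entails F C -> exists2 phi, satisfies phi F & ~ satisfies_clause phi C.
Proof. by move=> /existsNP[phi /not_implyP[? ?]]; exists phi. Qed.

Definition make_true C phi : V -> bool :=
  fun x => if (x, true) \in C then true else if (x, false) \in C then false else phi x.

Lemma make_true_in C phi l :
  is_clause C -> l \in C -> make_true C phi l.1 = l.2.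
Proof.
case: l => x [] clC xC; rewrite /make_true /= xC //.
by case: ifP => // /clC; rewrite /compl /= xC.
Qed.

Lemma make_true_keep C phi l :
  compl l \notin C -> phi l.1 = l.2 -> make_true C phi l.1 = l.2.
Proof.
by case: l => x [] /= /negPf nC e; rewrite /make_true nC e //; case: ifP.
Qed.

Lemma make_true_notin C phi l :
  l \notin C -> make_true C phi l.1 = l.2 -> phi l.1 = l.2.
Proof.
by case: l => x [] /= /negPf nC; rewrite /make_true nC //; case: ifP.
Qed.

Lemma mps_no_clash G C l : mps_for G C -> l \in lits G -> compl l \notin C.
Proof.
move=> [GC minG] /litsP[D DG lD]; apply/negP => lC.
have [phi phiG nphiC] := not_entails (minG _ (fproperD1 DG)).
apply: (nphiC); apply: GC => D' D'G.
have [->|neD] := eqVneq D' D; last by apply: phiG; rewrite !inE neD.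
(* If [phi] made [l] false, it would satisfy [compl l], a literal of [C]; so [phi] satisfies the
   removed premise [D] as well. *)
exists l => //; apply: contrapT => /eqP nl; apply: nphiC; exists (compl l) => //.
by move: nl; rewrite /=; case: (phi _) (l.2) => [] [].
Qed.

Lemma mps_pure_sub G C : mps_for G C -> pure G `<=` C.
Proof.
move=> [GC minG]; apply/fsubsetP => x; rewrite in_pure => /andP[xG nxG].
apply: contraPT GC => xC.
(* All premises containing [x] are dropped. Making [x] true in a countermodel [phi] restores them,
   harms no other premise since [compl x] does not occur, and leaves [C] falsified because [x] is
   not in [C]. *)
have ltG : [fset D in G | x \notin D] `<` G.
  rewrite fproperE; apply/andP; split.
    by apply/fsubsetP => D; rewrite !inE => /andP[].
  have /litsP[D DG xD] := xG; apply/fsubsetPn; exists D => //.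
  by rewrite !inE xD andbF.
have [phi phiG nphiC] := not_entails (minG _ ltG).
have clx : is_clause [fset x].
  move=> l; rewrite !inE => /eqP->; case: (x) => y [];
  by apply/negP => /eqP [].
move=> /(_ (make_true [fset x] phi)) [D DG|l lC].
  have [xD|xD] := boolP (x \in D).
    by exists x; rewrite ?make_true_in ?inE.
  have [|l lD phil] := phiG D; first by rewrite !inE DG.
  exists l => //; apply: make_true_keep => //; rewrite inE.
  apply: contraNneq nxG => <-; rewrite complK; by apply/litsP; exists D.
move=> /make_true_notin; rewrite inE => phil; apply: nphiC; exists l => //.
by apply: phil; apply: contraNneq xC => <-.
Qed.

Lemma mps_entails_pure G C :
  is_clause C -> mps_for G C -> entails G (pure G).
Proof.
move=> clC mG phi phiG.
(* Making [N] true falsifies the literals of [C] foreign to [G] and breaks no literal of [G]. The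
   literal of [C] that is still satisfied therefore occurs in [G], and is pure by [mps_no_clash]. *)
pose N := [fset compl l | l in C `\` lits G].
have inN l : (compl l \in N) = (l \in C `\` lits G).
  by rewrite mem_imfset //; apply: inv_inj complK.
have clN : is_clause N.
  move=> l; rewrite -{1}(complK l) !inN !inE => /andP[_ lC].
  by apply/negP => /andP[_ /clC]; rewrite lC.
have [D DG|l lC psil] := mG.1 (make_true N phi).
  have [l lD phil] := phiG _ DG; exists l => //; apply: make_true_keep => //.
  by rewrite inN inE; apply/nandP; left; rewrite negbK; apply/litsP; exists D.
have [lG|lG] := boolP (l \in lits G).
  exists l.
    rewrite in_pure lG; apply/negP => /(mps_no_clash mG).
    by rewrite complK lC.
  apply: make_true_notin psil; rewrite -(complK l) inN inE.
  by rewrite (negPf (clC _ lC)) andbF.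
have := @make_true_in N phi (compl l) clN.
by rewrite inN inE lG lC psil => /(_ isT); case: (l) => y [].
Qed.

(** Replaces the unknown clause by a canonical one: a subset entailing [pure G] would also entail
    every clause containing it, in particular the original one. *)
Lemma is_mpsP G : is_mps G <-> mps_for G (pure G).
Proof.
split=> [[C clC mG]|mG]; last by exists (pure G) => //; apply: is_clause_pure.
split=> [|G' ltG G'p]; first exact: mps_entails_pure mG.
apply: (mG.2 _ ltG) => phi /G'p; exact/satisfies_clause_sub/mps_pure_sub.
Qed.

End MinimalPremiseSets.

(** * Implicates of the doped clause-set *)

Section Doping.
Set Implicit Arguments.
Unset Strict Implicit.
Local Open Scope fset_scope.
Variables (V : choiceType) (F : {fset preclause V}) (u : preclause V -> V).
Hypothesis hu : doping_vars F u.
Implicit Types (l : literal V) (C D E K : preclause V) (G : {fset preclause V}).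

Definition undoped K : Prop := forall l C, C \in F -> l \in K -> l.1 != u C.

(** Normal form for clauses without negative doping literals; inclusion and entailment are then
    decided on [G] and [K]. *)
Definition doped_clause G K : preclause V := K `|` [fset (u C, true) | C in G].

Lemma in_doped_clause G K l :
  reflect (l \in K \/ exists2 C, C \in G & l = (u C, true))
          (l \in doped_clause G K).
Proof.
rewrite in_fsetU; apply: (iffP orP) => -[]; try by left.
  by move/imfsetP; right.
by move=> lG; right; apply/imfsetP.
Qed.

Lemma undoped_in C : C \in F -> undoped C.
Proof.
by move=> CF l D DF lC; apply: contraNneq (hu.2 _ DF) => <-; apply: in_var lC.
Qed.

Lemma undoped_sub K K' : K `<=` K' -> undoped K' -> undoped K.
Proof. by move=> /fsubsetP s uK l C CF /s; apply: uK. Qed.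

Lemma undoped_pure G : G `<=` F -> undoped (pure G).
Proof.
move=> /fsubsetP GF l C CF; rewrite in_pure => /andP[/litsP[D /GF DF lD] _].
exact: undoped_in lD.
Qed.

Lemma in_dope G D :
  reflect (exists2 C, C \in G & D = (u C, true) |` C) (D \in dope u G).
Proof. exact: imfsetP. Qed.

Lemma is_clause_doped_clause G K :
  G `<=` F -> undoped K -> is_clause K -> is_clause (doped_clause G K).
Proof.
move=> /fsubsetP GF uK clK l /in_doped_clause[lK|[C CG ->]]; apply/in_doped_clause.
  case=> [|[C /GF CF e]]; first exact/negP/clK.
  by have /eqP[] := uK _ _ CF lK; case: e.
case=> [/(uK _ _ (GF _ CG))|[D _ []//]]; by rewrite eqxx.
Qed.

Lemma doped_clause_sub G K G' K' :
    G `<=` F -> G' `<=` F -> undoped K -> undoped K' ->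
  (doped_clause G K `<=` doped_clause G' K') = (G `<=` G') && (K `<=` K').
Proof.
move=> /fsubsetP GF /fsubsetP GF' uK uK'; apply/fsubsetP/andP => [s|].
  split; apply/fsubsetP; [move=> C CG|move=> l lK].
    have /s/in_doped_clause[]: (u C, true) \in doped_clause G K.
      by apply/in_doped_clause; right; exists C.
      by move/(uK' _ _ (GF _ CG)); rewrite eqxx.
    by case=> D DG [] /(hu.1 _ _ (GF _ CG) (GF' _ DG)) ->.
  have /s/in_doped_clause[//|[C CG e]]: l \in doped_clause G K.
    by apply/in_doped_clause; left.
  by have := uK _ _ (GF' _ CG) lK; rewrite e eqxx.
move=> [/fsubsetP sG /fsubsetP sK] l /in_doped_clause[/sK lK|[C /sG CG ->]].
  by apply/in_doped_clause; left.
by apply/in_doped_clause; right; exists C.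
Qed.

Lemma entails_doped_clause G K :
    G `<=` F -> undoped K ->
  entails (dope u F) (doped_clause G K) <-> entails G K.
Proof.
move=> /fsubsetP GF uK; split=> ent phi phiS.
  (* Doping variables of [G] become false, so that the doped clause can only be satisfied through
     [K]; those of the rest of [F] become true, so that their doped clauses hold for free. *)
  pose psi x := if x \in [fset u C | C in G] then false
                else if x \in [fset u C | C in F] then true else phi x.
  have psiE K' l : undoped K' -> l \in K' -> psi l.1 = phi l.1.
    move=> uK' lK'; rewrite /psi !ifF //; apply/negP => /imfsetP[/= C CF e].
      by have := uK' _ _ CF lK'; rewrite e eqxx.
    by have := uK' _ _ (GF _ CF) lK'; rewrite e eqxx.
  have [D /in_dope[C CF ->]|l /in_doped_clause[lK|[C CG ->]]] := ent psi.
  - have [CG|CG] := boolP (C \in G).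
      have [l lC phil] := phiS _ CG.
      exists l; first by rewrite inE lC orbT.
      by rewrite (psiE C) //; apply: undoped_in.
    exists (u C, true); rewrite ?inE ?eqxx //= /psi ifF; first by rewrite in_imfset.
    apply/negP => /imfsetP[/= C' CG' /(hu.1 _ _ CF (GF _ CG')) e].
    by rewrite e CG' in CG.
  - by rewrite (psiE K) // => phil; exists l.
  - by rewrite /= /psi in_imfset.
(* Either a doping literal of [G] already satisfies the doped clause, or all of them are false and
   [phi] must satisfy [G] itself. *)
have [[C CG uC]|nu] := pselect (exists2 C, C \in G & phi (u C)).
  by exists (u C, true) => //; apply/in_doped_clause; right; exists C.
have [C CG|l lK phil] := ent phi; last first.
  by exists l => //; apply/in_doped_clause; left.
have [|l] := phiS ((u C, true) |` C); first by apply/in_dope; exists C => //; apply: GF.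
rewrite !inE => /orP[/eqP-> /= uC|lC phil]; last by exists l.
by case: nu; exists C.
Qed.

Lemma doped_clauseP E :
    (forall C, C \in F -> (u C, false) \notin E) ->
  exists G K, [/\ G `<=` F, undoped K & E = doped_clause G K].
Proof.
move=> nE; exists [fset C in F | (u C, true) \in E].
exists [fset l in E | l.1 \notin [fset u C | C in F]]; split.
- by apply/fsubsetP => C; rewrite !inE => /andP[].
- move=> l C CF; rewrite !inE => /andP[_]; apply: contraNneq => ->.
  by rewrite in_imfset.
apply/fsetP => l; apply/idP/in_doped_clause => [lE|]; last first.
  by case=> [|[C]]; rewrite !inE => /andP[] // _ ? ->.
have [/imfsetP[/= C CF e]|nl] := boolP (l.1 \in [fset u C | C in F]); last first.
  by left; rewrite !inE lE.
right; case: l lE e => x [] /= lE e; rewrite e in lE *.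
  by exists C; rewrite // !inE CF.
by have := nE _ CF; rewrite lE.
Qed.

(** A doping variable occurs only positively in the doped set, so setting it to true preserves every
    model. The negative literal then contributes nothing, and deleting it would leave a smaller
    implicate. *)
Lemma prc0_no_negative_doping E C :
  prc0 (dope u F) E -> C \in F -> (u C, false) \notin E.
Proof.
move=> [[clE FE] minE] CF; apply/negP => uE.
suff /minE/negP[] : implicate (dope u F) (E `\ (u C, false)) by apply: fproperD1.
split; first exact/is_clause_sub/clE/fsubD1set.
move=> phi phiF; pose psi := make_true [fset (u C, true)] phi.
have [D DF|l lE psil] := FE psi.
  have [l lD phil] := phiF _ DF; exists l => //; apply: make_true_keep => //.
  rewrite inE (inv_eq (@complK V)) /compl /=; apply: contraTneq lD => ->.
  move: DF => /in_dope[D' D'F ->]; rewrite !inE negb_or; apply/andP; split.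
    by apply/negP => /eqP[].
  by apply/negP => /(undoped_in D'F CF); rewrite eqxx.
exists l; last first.
  apply: make_true_notin psil; rewrite inE; apply: contraTneq lE => ->.
  exact: (clE (u C, false)).
rewrite !inE lE andbT; apply: contra_eqN psil => /eqP->.
by rewrite /psi /make_true /= inE eqxx.
Qed.

(** Each doping variable is new and occurs in one polarity only: its literal is pure, and the purity
    of old literals is unaffected. *)
Lemma pure_dope G : G `<=` F -> pure (dope u G) = doped_clause G (pure G).
Proof.
move=> /[dup] sGF /fsubsetP GF.
have litsE l : l \in lits (dope u G) = (l \in doped_clause G (lits G)).
  apply/litsP/in_doped_clause => [[D /in_dope[C CG ->]]|[/litsP[C CG lC]|[C CG ->]]].
  - by rewrite !inE => /orP[/eqP->|lC]; [right; exists C|left; apply/litsP; exists C].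
  - by exists ((u C, true) |` C); [apply/in_dope; exists C|rewrite !inE lC orbT].
  - by exists ((u C, true) |` C); [apply/in_dope; exists C|rewrite !inE eqxx].
have uG : undoped (lits G).
  by move=> l C CF /litsP[D /GF DF]; apply: undoped_in.
apply/fsetP => l; rewrite in_pure !litsE; apply/andP/in_doped_clause.
  case=> /in_doped_clause[lG|]; last by right.
  move=> nl; left; rewrite in_pure lG; apply: contra nl => cl.
  by apply/in_doped_clause; left.
case=> [|[C CG ->]].
  rewrite in_pure => /andP[lG nl]; split; apply/in_doped_clause; first by left.
  case=> [|[C /GF CF e]]; first exact/negP.
  by have /eqP[] := uG _ _ CF lG; case: e.
split; apply/in_doped_clause; first by right; exists C.
case=> [/(uG _ _ (GF _ CG))|[D _ []//]]; by rewrite eqxx.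
Qed.

Lemma prc0_doped_clause G K :
    G `<=` F -> undoped K ->
  prc0 (dope u F) (doped_clause G K) <-> is_mps G /\ K = pure G.
Proof.
move=> GF uK; split.
  move=> [[clE /(entails_doped_clause GF uK) GK] minE].
  have clK : is_clause K by apply: is_clause_sub clE; apply: fsubsetUl.
  (* Minimality of the prime implicate, read on pairs: fixing [K] makes [G] a minimal premise set,
     fixing [G] forces [K] to be [pure G]. *)
  have minGK G' K' : G' `<=` G -> K' `<=` K -> entails G' K' ->
      (G `<=` G') && (K `<=` K').
    move=> sG sK ent; have GF' := fsubset_trans sG GF.
    have uK' := undoped_sub sK uK.
    rewrite -doped_clause_sub //; apply: contraT => nsub.
    have /minE/negP[] : implicate (dope u F) (doped_clause G' K').
      split; last exact/entails_doped_clause.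
      by apply: is_clause_doped_clause => //; apply: is_clause_sub clK.
    by rewrite fproperE doped_clause_sub // sG sK.
  have mG : mps_for G K.
    split=> // G' ltG /(minGK _ _ (fproper_sub ltG) (fsubset_refl _)).
    by move: ltG; rewrite fproperE => /andP[_ /negPf->].
  split; first by exists K.
  apply/eqP; rewrite eqEfsubset mps_pure_sub // andbT.
  have /andP[//] := minGK _ _ (fsubset_refl G) (mps_pure_sub mG)
                      (mps_entails_pure clK mG).
move=> [/is_mpsP mG eK]; split; first split.
- by rewrite eK; apply: is_clause_doped_clause; rewrite -?eK // eK; apply: is_clause_pure.
- by apply/entails_doped_clause => //; rewrite eK; apply: mG.1.
move=> E [clE FE]; apply/negP; rewrite fproperE => /andP[sE nsE].
(* A subset of a doped clause has no negative doping literal either, so it has the same normal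
   form. *)
have [|G' [K' [GF' uK' eE]]] := @doped_clauseP E.
  move=> C CF; apply/negP => /(fsubsetP sE) /in_doped_clause[|[D _ []//]].
  by move=> /(uK _ _ CF); rewrite eqxx.
move: sE nsE FE; rewrite eE !doped_clause_sub // eK => /andP[sG sK] nsE.
move=> /(entails_doped_clause GF' uK') ent.
have [eG|ltG] := eqVfproper sG; last first.
  by apply: (mG.2 _ ltG) => phi /ent; apply: satisfies_clause_sub.
(* With equal doping parts, [G] is also a minimal premise set for the smaller [K'], which must then
   contain [pure G]. *)
move/negP: nsE; apply; rewrite eG fsubset_refl; apply: mps_pure_sub.
split=> [|G'' ltG ent'']; first by rewrite -eG.
by apply: (mG.2 _ ltG) => phi /ent''; apply: satisfies_clause_sub.
Qed.

End Doping.

Theorem theorem4p18 (V : choiceType) (F : {fset preclause V})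
    (u : preclause V -> V)
    (hF : is_clauseset F) (hu : doping_vars F u) :
  set_bij (mps F) (prc0 (dope u F))
    (fun F' : {fset preclause V} => pure (dope u F')).
Proof.
split.
- move=> G [GF mG]; rewrite (pure_dope hu) //.
  by apply/prc0_doped_clause => //; apply: undoped_pure.
(* Injectivity: the doping literals in the image determine the subset. *)
- move=> G G' /set_mem[GF _] /set_mem[GF' _].
  rewrite !(pure_dope hu) // => /eqP; rewrite eqEfsubset.
  rewrite !(doped_clause_sub hu) //; try exact: undoped_pure.
  by move=> /andP[/andP[s _] /andP[s' _]]; apply/eqP; rewrite eqEfsubset s.
- move=> E primeE.
  have [|G [K [GF uK eE]]] := @doped_clauseP _ F u E.
    by move=> C; apply: prc0_no_negative_doping.
  rewrite eE in primeE *; have [mG eK] := (prc0_doped_clause hu GF uK).1 primeE.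
  by exists G; rewrite // (pure_dope hu) // -eK.
Qed.
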